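(* Let $q$ be an odd prime power, $m\geq 2$ an integer and $n=\frac{q^m-1}{2}$. Let $\delta$ be an integer with $2\leq \delta\leq q^{m/2}+1$ if $m$ is even, and $2\leq \delta\leq \frac{q^{(m+1)/2}+1}{2}$ if $m$ is odd. Then the negacyclic BCH code $\mathcal{C}_{(q,n,\delta,0)}$ has parameters $$\left[n,\ n-m\left\lceil \frac{(2\delta-3)(q-1)}{2q}\right\rceil,\ d\right]$$ and generator polynomial $$g(x)=\prod_{\substack{0\leq i\leq \delta-2\\ i\not\equiv \frac{q-1}{2} \pmod{q}}}\mathbb{M}_{\beta^{1+2i}}(x),$$ where $d\geq \delta+1$ if $\delta\equiv \frac{q+1}{2}\pmod q$, and $d\geq \delta$ otherwise.
   Context: Let $q$ be an odd prime power and $n$ a positive integer with $\gcd(n,q)=1$. Let $\ell$ be the multiplicative order of $q$ modulo $2n$, let $\alpha$ be a primitive element of $\mathrm{GF}(q^\ell)$ and $\beta=\alpha^{(q^\ell-1)/(2n)}$, a primitive $2n$-th root of unity. For an integer $i$, $\mathbb{M}_{\beta^{1+2i}}(x)$ denotes the minimal polynomial of $\beta^{1+2i}$ over $\mathrm{GF}(q)$. For $2\leq\delta\leq n$ and an integer $b$, let $g_{(q,n,\delta,b)}(x)=\mathrm{lcm}\big(\mathbb{M}_{\beta^{1+2b}}(x),\mathbb{M}_{\beta^{1+2(b+1)}}(x),\ldots,\mathbb{M}_{\beta^{1+2(b+\delta-2)}}(x)\big)$. The negacyclic BCH code $\mathcal{C}_{(q,n,\delta,b)}$ is the ideal generated by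 $g_{(q,n,\delta,b)}(x)$ in $\mathrm{GF}(q)[x]/(x^n+1)$, viewed as a linear code of length $n$ over $\mathrm{GF}(q)$ (a polynomial $c_0+c_1x+\cdots+c_{n-1}x^{n-1}$ identified with $(c_0,\dots,c_{n-1})$). Parameters $[n,k,d]$ mean length, dimension and minimum Hamming distance. *)

(* Defs.v *)
From HB Require Import structures.
From mathcomp Require Import all_boot all_order all_algebra all_field.
From Stdlib Require Import ClassicalEpsilon.
Set Implicit Arguments. Unset Strict Implicit. Unset Printing Implicit Defensive.
Import GRing.Theory.
Local Open Scope ring_scope.

Definition minpoly_over (F : fieldType) (L : fieldExtType F) (x : L) : {poly F} :=
  epsilon (inhabits 0) (fun p : {poly F} =>
    [/\ p \is monic, root (map_poly (in_alg L) p) x &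
        forall r : {poly F}, r != 0 -> root (map_poly (in_alg L) r) x ->
          (size p <= size r)%N]).

Definition lcm_monic (F : fieldType) (p r : {poly F}) : {poly F} :=
  let l := (p * r) %/ gcdp p r in (lead_coef l)^-1 *: l.

Definition lcm_seq (F : fieldType) (s : seq {poly F}) : {poly F} :=
  foldr (@lcm_monic F) 1 s.

Definition negaBCH_gen (F : fieldType) (L : fieldExtType F) (beta : L)
    (delta b : nat) : {poly F} :=
  lcm_seq [seq minpoly_over (beta ^+ (1 + 2 * (b + j))) | j <- iota 0 delta.-1].

(* The ideal generated by g in F[x]/(x^n+1), as a linear code of length n:
   the row space of the matrix whose i-th row is the coefficient vector of
   x^i g(x) mod (x^n + 1), i < n. *)
Definition negacyc_gen_mx (F : fieldType) (n : nat) (g : {poly F}) : 'M[F]_n :=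
  \matrix_(i < n, j < n) ((('X^i * g) %% ('X^n + 1)) `_ j).

Definition hdist (F : fieldType) (n : nat) (c1 c2 : 'rV[F]_n) : nat :=
  #|[set i : 'I_n | c1 0 i != c2 0 i]|.

(* Main.v *)
(* Here l = m and beta is a primitive (q^m - 1)-th root of unity.  Every odd
   exponent a at most 2 delta - 3 is b q^k with b odd, prime to q and no larger
   than a, and distinct such b lie in distinct q-cyclotomic cosets modulo
   q^m - 1, all of size m.  So the minimal polynomials attached to the b's are
   pairwise coprime of degree m, and their product is the lcm; counting the b's
   gives the dimension.  The distance is the BCH bound for the delta - 1 zeros
   beta (beta^2)^j; when delta = (q+1)/2 mod q, the next exponent 2 delta - 1 is
   divisible by q, hence conjugate to a smaller one, and gives one more zero. *)
Require Import Defs.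
From HB Require Import structures.
From mathcomp Require Import all_boot all_order all_algebra all_field zify.
From Stdlib Require Import ClassicalEpsilon.
Import GRing.Theory.
Local Open Scope ring_scope.
Set Implicit Arguments. Unset Strict Implicit. Unset Printing Implicit Defensive.

(** * Cyclotomic cosets of small exponents modulo [q ^ m - 1] *)

Section Cosets.
Local Open Scope nat_scope.
Variables q m : nat.
Hypotheses (q_odd : odd q) (q_gt1 : 1 < q) (m_gt1 : 1 < m).

(** Chosen to exceed every exponent that occurs: the range of [delta] makes [2 * delta - 3] at most
    [2 q^(m/2) - 1] for even [m] and [q^((m+1)/2) - 2] for odd [m]. *)
Definition coset_bound := (if odd m then 1 else 2) * q ^ uphalf m.

Definition small_rep a := [&& odd a, ~~ (q %| a) & a < coset_bound].

Let q_ge3 : 3 <= q.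
Proof. by case: q q_odd q_gt1 => [|[|[|?]]]. Qed.

Let expq_gt0 k : 0 < q ^ k.
Proof. by rewrite expn_gt0 (ltnW q_gt1). Qed.

Let expq_ge3 k : 0 < k -> 3 <= q ^ k.
Proof.
by move=> k_gt0; apply: (leq_trans q_ge3); rewrite -[q in q <= _]expn1 leq_exp2l.
Qed.

Let expq_m : q ^ m = q ^ m./2 * q ^ uphalf m.
Proof. by rewrite -expnD addnC uphalf_half -addnA addnn odd_double_half. Qed.

Lemma small_rep_lt a : small_rep a -> a < q ^ m - 1.
Proof.
case/and3P=> _ _ lt_a; apply: leq_trans lt_a _; rewrite /coset_bound expq_m.
have h : 3 * q ^ uphalf m <= q ^ m./2 * q ^ uphalf m.
  by rewrite leq_mul2r expq_ge3 ?orbT; lia.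
have := expq_gt0 (uphalf m); case: odd; lia.
Qed.

(** If [a * q ^ j] is below the modulus, it is its own residue and a multiple of [q], which [b] is
    not. The modulus can be reached only when [m = 2 j]. *)
Lemma small_rep_mod_half a b j :
  small_rep a -> small_rep b -> 0 < j -> j.*2 <= m ->
  a * q ^ j != b %[mod q ^ m - 1].
Proof.
move=> ra rb j_gt0 le_jm; have lt_bN := small_rep_lt rb.
case/and3P: ra => a_odd qNa lt_a; case/and3P: rb => b_odd qNb lt_b.
have [lt_aqN|] := ltnP (a * q ^ j) (q ^ m - 1).
  rewrite !modn_small //; apply: contraNneq qNb => <-.
  by rewrite dvdn_mull // -(prednK j_gt0) expnS dvdn_mulr.
rewrite leqNgt => /negP leN.
case m_odd: (odd m) lt_a lt_b; rewrite /coset_bound m_odd => lt_a lt_b.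
  case: leN.
  (* For odd [m], [a * q ^ j] is at most [q ^ m - q ^ m./2], below the modulus. *)
  have le_j : a * q ^ j <= a * q ^ m./2 by rewrite leq_mul2l leq_exp2l //; lia.
  have h : a.+1 * q ^ m./2 <= q ^ uphalf m * q ^ m./2.
    by rewrite leq_mul2r; lia.
  have h3 : 3 <= q ^ m./2 by apply: expq_ge3; lia.
  rewrite expq_m; lia.
(* For even [m] and [j < m/2], [a * q ^ j] is below [2 q^(m-1)], at most two thirds of [q ^ m]. *)
have [j_lt|j_ge] := ltnP j m./2.
  case: leN; have x_gt0 := expq_gt0 (m./2).-1.
  have le_j : a * q ^ j <= a * q ^ (m./2).-1.
    by rewrite leq_mul2l leq_exp2l //; lia.
  have h : a.+1 * q ^ (m./2).-1 <= 2 * q ^ uphalf m * q ^ (m./2).-1.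
    by rewrite leq_mul2r; lia.
  have : 3 * (q ^ uphalf m * q ^ (m./2).-1) <= q ^ m.
    rewrite expq_m -[m./2 in X in _ <= X]prednK; last lia.
    by rewrite expnS -mulnA [X in q * X]mulnC leq_mul2r q_ge3 orbT.
  have : 0 < q ^ uphalf m * q ^ (m./2).-1 by rewrite muln_gt0 !expq_gt0.
  lia.
(* The remaining case j = m/2: write a = a1 q^j + a0 with a1 < 2, so that
   a q^j = a0 q^j + a1 modulo q^m - 1; this is too large unless a0 = 1, and
   then the oddness of a excludes a1 = 1, i.e. the self-paired q^j + 1. *)
have uE : uphalf m = j by lia.
have hE : m./2 = j by lia.
have NE := expq_m; rewrite hE uE in NE.
move: lt_a lt_b; rewrite uE => lt_a lt_b.
have Q_odd : odd (q ^ j) by rewrite oddX q_odd orbT.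
have Q_ge3 : 3 <= q ^ j by apply: expq_ge3.
have QQ : 3 * q ^ j <= q ^ j * q ^ j by rewrite leq_mul2r Q_ge3 orbT.
rewrite NE in lt_bN leN *.
have [a0 [a1 [aE a0lt a1lt]]] :
    exists a0 a1, [/\ a = a1 * q ^ j + a0, a0 < q ^ j & a1 < 2].
  exists (a %% q ^ j), (a %/ q ^ j).
  by rewrite -divn_eq ltn_mod expq_gt0 ltn_divLR ?expq_gt0.
have h0 : a0 * q ^ j <= (q ^ j - 1) * q ^ j by rewrite leq_mul2r; lia.
have a0E : a0 * q ^ j + a1 < q ^ j * q ^ j - 1.
  by rewrite mulnBl mul1n in h0; lia.
have -> : a * q ^ j = a1 * (q ^ j * q ^ j - 1) + (a0 * q ^ j + a1).
  case: a1 aE a1lt {a0E} => [|[|//]] -> _; lia.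
rewrite modnMDl !modn_small //.
have a0N0 : a0 != 0.
  apply: contraNneq qNa => a00; rewrite aE a00 addn0 dvdn_mull //.
  by rewrite -(prednK j_gt0) expnS dvdn_mulr.
have [a0_1|a0N1] := eqVneq a0 1; last first.
  have : 2 * q ^ j <= a0 * q ^ j by rewrite leq_mul2r; lia.
  by rewrite neq_ltn; lia.
have a1_0 : a1 = 0.
  case: a1 a1lt aE {a0E} => [|[|//]] // _ aE.
  by move: a_odd; rewrite aE a0_1 mul1n oddD Q_odd.
apply: contraNneq qNb => <-; rewrite a0_1 a1_0 mul1n addn0.
by rewrite -(prednK j_gt0) expnS dvdn_mulr.
Qed.

Let mod_expq_m a : a * q ^ m = a %[mod q ^ m - 1].
Proof. by rewrite -[X in a * X](subnK (expq_gt0 m)) mulnDr muln1 modnMDl. Qed.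

(** Since [q ^ m] is 1 modulo [q ^ m - 1], a shift by [j > m/2] from [a] to [b] is a shift by
    [m - j < m/2] from [b] to [a]. *)
Lemma small_rep_mod a b j :
  small_rep a -> small_rep b -> 0 < j < m -> a * q ^ j != b %[mod q ^ m - 1].
Proof.
move=> ra rb /andP[j_gt0 lt_jm].
have [le_jm|lt_mj] := leqP j.*2 m; first exact: small_rep_mod_half.
have : b * q ^ (m - j) != a %[mod q ^ m - 1].
  by apply: small_rep_mod_half => //; lia.
apply: contraNneq => eqab.
by rewrite -modnMml -eqab modnMml -mulnA -expnD subnKC ?mod_expq_m // ltnW.
Qed.

(** Multiplying by [q ^ (m - i)] cancels the smaller shift. The conclusion says at once that
    distinct representatives have disjoint cosets and that each coset has [m] elements. *)
Lemma small_rep_mod_inj a b i j :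
  small_rep a -> small_rep b -> i < m -> j < m ->
  a * q ^ i = b * q ^ j %[mod q ^ m - 1] -> a = b /\ i = j.
Proof.
wlog le_ij : a b i j / i <= j => [th|] ra rb lt_i lt_j eqab.
  case/orP: (leq_total i j) => le_ij; first exact: th.
  by have [-> ->] := th _ _ _ _ le_ij rb ra lt_j lt_i (esym eqab).
have eqab' : b * q ^ (j - i) = a %[mod q ^ m - 1].
  have e : b * q ^ (j - i) * q ^ m = b * q ^ j * q ^ (m - i).
    by rewrite -!mulnA -!expnD; congr (_ * _ ^ _); lia.
  rewrite -mod_expq_m e -modnMml -eqab modnMml -mulnA -expnD.
  by rewrite subnKC ?mod_expq_m // ltnW.
have [eq_ij|neq_ij] := eqVneq i j.
  split=> //; move: eqab'.
  by rewrite eq_ij subnn muln1 !modn_small //; exact: small_rep_lt.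
have : 0 < j - i < m.
  rewrite subn_gt0 ltn_neqAle neq_ij le_ij.
  exact: leq_ltn_trans (leq_subr _ _) lt_j.
by move/(small_rep_mod rb ra); rewrite eqab' eqxx.
Qed.

End Cosets.

(** * Exponents divisible by [q]: counting them and stripping powers of [q] *)

(** The right side is the ceiling of [(2D - 1)(q - 1) / (2q)], written as a floor; [D] will be
    [delta - 1]. *)
Lemma count_nonmultiples q D : odd q -> (0 < D)%N ->
  count (fun i => i != (q - 1) %/ 2 %[mod q])%N (iota 0 D)
    = (((2 * D - 1) * (q - 1) + (2 * q).-1) %/ (2 * q))%N.
Proof.
move=> q_odd D_gt0; set s := ((q - 1) %/ 2)%N.
have qE : q = (2 * s).+1 by rewrite /s; lia.
(* As [q = 2 s + 1], [i] is [s] modulo [q] exactly when [q] divides [i + s + 1], so the excluded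
   indices below [E] number [(E + s) %/ q]. *)
have countE E : (count (fun i => i != s %[mod q]) (iota 0 E) + (E + s) %/ q = E)%N.
  elim: E => [|E IH]; first by rewrite /= divn_small //; lia.
  rewrite -addn1 iotaD count_cat /= add0n addn0 addn1 addSn divnS; last lia.
  have -> : (q %| (E + s).+1)%N = (E == s %[mod q])%N.
    rewrite -(eqn_modDr s.+1) addnS (_ : s + s.+1 = q)%N ?modnn //.
    by rewrite addnS addnn -mul2n -qE.
  by case: eqP => _; lia.
have tE := divn_eq (D + s) q; have := countE D; set c := count _ _.
set t := ((D + s) %/ q)%N in tE *; set r := ((D + s) %% q)%N in tE.
have rlt : (r < q)%N by rewrite ltn_mod; lia.
move=> cE.
(* Writing [D + s = t q + r] and [c = D - t], the numerator is [c] times [2q] plus a remainder below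
   [2q]. *)
have -> : ((2 * D - 1) * (q - 1) + (2 * q).-1
           = c * (2 * q) + ((2 * q).-1 - 2 * r))%N.
  have : (D * q = c * q + t * q)%N by rewrite -cE mulnDl.
  have : (D + q <= D * q + 1)%N by rewrite -(prednK D_gt0) mulSn; clear -qE; nia.
  rewrite mulnBl mulnBr mul1n !muln1; lia.
rewrite divnMDl ?divn_small ?addn0 //; lia.
Qed.

(** Doubling is invertible modulo an odd [q], and [2 (i + s + 1) = (1 + 2 i) + q]. This links the
    index condition of the product to the exponents. *)
Lemma dvdn_double_succ q i :
  odd q -> (q %| 1 + 2 * i)%N = (i == (q - 1) %/ 2 %[mod q])%N.
Proof.
move=> q_odd; set s := ((q - 1) %/ 2)%N.
have qE : q = (1 + 2 * s)%N by rewrite /s; lia.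
rewrite -[RHS](eqn_modDr s.+1) (_ : s + s.+1 = q)%N ?modnn; last by lia.
rewrite -[RHS]/(q %| i + s.+1)%N -[RHS](@Gauss_dvdr q 2) ?coprimen2 //.
rewrite (_ : 2 * (i + s.+1) = 1 + 2 * i + q)%N; last by lia.
by rewrite [RHS]dvdn_addl.
Qed.

(** Factors [q] are removed one at a time. The bound [b <= a] keeps the representative among the
    exponents defining the code. *)
Lemma small_repP q m a : odd q -> (1 < q)%N -> odd a -> (a < coset_bound q m)%N ->
  exists b k, [/\ small_rep q m b, (b <= a)%N & a = (b * q ^ k)%N].
Proof.
move=> q_odd q_gt1; elim/ltn_ind: a => a IH a_odd lt_a.
have [/dvdnP[b aE]|qNa] := boolP (q %| a)%N; last first.
  by exists a, 0%N; rewrite muln1 /small_rep a_odd qNa lt_a.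
have b_odd : odd b by move: a_odd; rewrite aE oddM => /andP[].
have lt_ba : (b < a)%N by rewrite aE -[X in (X < _)%N]muln1 ltn_pmul2l // odd_gt0.
have [c [k [c_rep le_cb bE]]] := IH b lt_ba b_odd (ltn_trans lt_ba lt_a).
exists c, k.+1; split=> //; first exact: leq_trans (ltnW lt_ba).
by rewrite aE bE expnSr mulnA.
Qed.

(** * Minimal polynomials over the base field *)

Section MinpolyOver.
Variables (F : fieldType) (L : fieldExtType F).
Implicit Types (x : L) (r : {poly F}).

Lemma minpoly_overP x :
  [/\ minpoly_over x \is monic, root (map_poly (in_alg L) (minpoly_over x)) x &
      forall r, r != 0 -> root (map_poly (in_alg L) r) x ->
        (size (minpoly_over x) <= size r)%N].
Proof.
apply: (epsilon_spec (inhabits 0) (fun p : {poly F} =>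
    [/\ p \is monic, root (map_poly (in_alg L) p) x &
        forall r : {poly F}, r != 0 -> root (map_poly (in_alg L) r) x ->
          (size p <= size r)%N])).
have [p pE] : exists p, minPoly 1%AS x = map_poly (in_alg L) p.
  exact/polyOver1P/minPolyOver.
exists p; split; first by rewrite -(map_monic (in_alg L)) -pE monic_minPoly.
  by rewrite -pE root_minPoly.
move=> r r0 rx; rewrite -(size_map_poly (in_alg L) p) -(size_map_poly (in_alg L) r).
apply: dvdp_leq; first by rewrite map_poly_eq0.
rewrite -pE minPoly_dvdp //; apply/polyOver1P; by exists r.
Qed.

Lemma minpoly_over_monic x : minpoly_over x \is monic.
Proof. by have [] := minpoly_overP x. Qed.

Lemma dvdp_minpoly_over x r :
  (minpoly_over x %| r) = root (map_poly (in_alg L) r) x.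
Proof.
have [mon rt min] := minpoly_overP x; apply/idP/idP => [|rx].
  by rewrite -(dvdp_map (in_alg L)) => /dvdpP[u ->]; rewrite rootM rt orbT.
apply/modp_eq0P/eqP; apply: contraTT isT => nz.
have := min _ nz; rewrite map_modp /root horner_mod // => /(_ rx).
by rewrite leqNgt ltn_modp monic_neq0.
Qed.

Lemma size_minpoly_over x : (size (minpoly_over x) <= (\dim {:L}).+1)%N.
Proof.
have [p pE] : exists p, minPoly 1%AS x = map_poly (in_alg L) p.
  exact/polyOver1P/minPolyOver.
have [_ _ /(_ p)] := minpoly_overP x; rewrite -(size_map_poly (in_alg L) p) -pE.
rewrite root_minPoly -(map_poly_eq0 (in_alg L)) -pE monic_neq0 ?monic_minPoly //.
move=> /(_ isT isT)/leq_trans; apply; rewrite size_minPoly ltnS.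
have := dim_Fadjoin 1%AS x; rewrite dimv1 muln1 => <-.
exact/dimvS/subvf.
Qed.

End MinpolyOver.

(** * The Frobenius map of [L] over a finite field *)

Section Frobenius.
Variables (F : finFieldType) (L : fieldExtType F).

(** The order of [F] is a power of the characteristic, so raising to it is additive on [L], and it
    fixes the coefficients. *)
Lemma horner_map_card (p : {poly F}) (x : L) :
  (map_poly (in_alg L) p).[x ^+ #|F|] = (map_poly (in_alg L) p).[x] ^+ #|F|.
Proof.
have Lc : [pchar L].-nat #|F|.
  have [c c_prime cF] := finPcharP F.
  have -> : #|F| = (c ^ logn c #|F|)%N := card_pprimeChar cF.
  by rewrite pnatX pnatE // (pchar_lalg L) cF.
elim/poly_ind: p => [|p a IH].
  by rewrite rmorph0 !horner0 expr0n gtn_eqF // ltnW ?finNzRing_gt1.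
rewrite rmorphD rmorphM /= map_polyX map_polyC !hornerE IH exprDn_pchar //.
by rewrite exprMn -rmorphXn /= expf_card.
Qed.

End Frobenius.

(** * Least common multiples and products of monic polynomials *)

Section Lcm.
Variable F : fieldType.
Implicit Types (p r d : {poly F}) (s : seq {poly F}).

Lemma lcm_monic_monic p r : p != 0 -> r != 0 -> lcm_monic p r \is monic.
Proof.
move=> p0 r0; rewrite /lcm_monic monicE lead_coefZ mulVf // lead_coef_eq0.
rewrite divp_eq0 mulf_eq0 gcdp_eq0 (negPf p0) (negPf r0) /= -leqNgt.
by rewrite dvdp_leq ?mulf_neq0 // dvdp_mulr ?dvdp_gcdl.
Qed.

(** With [p = p' g], [r = r' g] and [g] the gcd, the lcm is [p' r' g] up to a unit; cancelling [g]
    leaves Gauss for the coprime [p'] and [r']. *)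
Lemma dvdp_lcm_monic p r d : p != 0 -> r != 0 ->
  (lcm_monic p r %| d) = (p %| d) && (r %| d).
Proof.
move=> p0 r0; have lc0 : lead_coef ((p * r) %/ gcdp p r) != 0.
  have := lcm_monic_monic p0 r0; rewrite monicE /lcm_monic lead_coefZ.
  by apply: contraTneq => ->; rewrite mulr0 eq_sym oner_eq0.
rewrite /lcm_monic dvdpZl ?invr_eq0 //.
have co : coprimep (p %/ gcdp p r) (r %/ gcdp p r) by rewrite coprimep_div_gcd ?p0.
have g0 : gcdp p r != 0 by rewrite gcdp_eq0 negb_and p0.
have pE := esym (divpK (dvdp_gcdl p r)); have rE := esym (divpK (dvdp_gcdr p r)).
move: pE rE co g0; move: (gcdp p r) (p %/ _) (r %/ _) => g p' r'.
move=> pE rE co g0; rewrite rE mulrA mulpK // {}pE.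
apply/idP/andP => [h|[hp hr]].
  split; apply: dvdp_trans h; first exact: dvdp_mulIl.
  by rewrite -mulrA [g * r']mulrC dvdp_mulIr.
have /dvdpP[e eE] : g %| d by apply: dvdp_trans hr; exact: dvdp_mulIr.
move: hp hr; rewrite eE mulrAC !dvdp_mul2r // => hp hr.
by rewrite Gauss_dvdp // hp.
Qed.

Lemma lcm_seq_monic s : {in s, forall p, p \is monic} -> lcm_seq s \is monic.
Proof.
elim: s => [|p s IH] mon; first exact: monic1.
apply: lcm_monic_monic; apply: monic_neq0; first by apply: mon; rewrite mem_head.
by apply: IH => r rs; apply: mon; rewrite inE rs orbT.
Qed.

Lemma dvdp_lcm_seq s d : {in s, forall p, p \is monic} ->
  (lcm_seq s %| d) = all (fun p => p %| d) s.
Proof.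
elim: s => [|p s IH] mon; first exact: dvd1p.
have mons : {in s, forall p, p \is monic}.
  by move=> r rs; apply: mon; rewrite inE rs orbT.
rewrite [lcm_seq _]/= dvdp_lcm_monic ?IH //; apply: monic_neq0.
  by apply: mon; rewrite mem_head.
exact: lcm_seq_monic.
Qed.

End Lcm.

Lemma dvdp_prod_coprime (F : fieldType) (I : eqType) (P : I -> {poly F})
    (s : seq I) (d : {poly F}) :
  {in s &, forall i j, i != j -> coprimep (P i) (P j)} -> uniq s ->
  (\prod_(i <- s) P i %| d) = all (fun i => P i %| d) s.
Proof.
elim: s => [|i s IH] co; first by rewrite big_nil dvd1p.
case/andP=> i_s s_uniq; rewrite big_cons Gauss_dvdp /= ?IH //.
  by move=> j k js ks; apply: co; rewrite inE ?js ?ks orbT.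
rewrite big_seq; apply: (big_ind (coprimep (P i))); first exact: coprimep1.
  by move=> p r cp cr; rewrite coprimepMr cp.
move=> j js; apply: co; rewrite ?mem_head ?inE ?js ?orbT //.
by apply: contraNneq i_s => ->.
Qed.

Lemma size_prod_monic (R : idomainType) (I : eqType) (P : I -> {poly R})
    (s : seq I) k :
  {in s, forall i, P i \is monic /\ size (P i) = k.+1} ->
  size (\prod_(i <- s) P i) = (k * size s).+1.
Proof.
elim: s => [|i s IH] h; first by rewrite big_nil size_poly1 muln0.
have hs : {in s, forall i, P i \is monic /\ size (P i) = k.+1}.
  by move=> j js; apply: h; rewrite inE js orbT.
have [mon sz] := h i (mem_head _ _).
rewrite big_cons size_monicM // ?IH // ?sz ?addSn ?mulnS ?addnS //.
by rewrite -size_poly_eq0 IH.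
Qed.

(** * Dimension of the negacyclic code generated by a divisor of [X^n + 1] *)

Section NegacyclicRank.
Variables (F : fieldType) (n : nat) (g : {poly F}).
Hypotheses (n_gt0 : (0 < n)%N) (g_monic : g \is monic) (g_dvd : g %| 'X^n + 1).

Let size_Xn1 : size ('X^n + 1 : {poly F}) = n.+1.
Proof. by rewrite -polyC1 size_XnaddC. Qed.

Let Xn1_neq0 : ('X^n + 1 : {poly F}) != 0.
Proof. by rewrite -size_poly_eq0 size_Xn1. Qed.

Let size_g_le : (size g <= n.+1)%N.
Proof. by rewrite -size_Xn1 dvdp_leq. Qed.

Let g_gt0 : (0 < size g)%N.
Proof. by rewrite size_poly_gt0 monic_neq0. Qed.

Let row_gen i : row i (negacyc_gen_mx n g) = poly_rV (('X^i * g) %% ('X^n + 1)).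
Proof. by apply/rowP=> j; rewrite !mxE. Qed.

Let size_mod p : (size (p %% ('X^n + 1 : {poly F}))%R <= n)%N.
Proof. by rewrite -ltnS -size_Xn1 ltn_modp. Qed.

Lemma dvdp_negacyc_gen (c : 'rV[F]_n) :
  (c <= negacyc_gen_mx n g)%MS -> g %| rVpoly c.
Proof.
case/submxP=> D ->; rewrite mulmx_sum_row raddf_sum /=.
apply: (big_ind (fun p => g %| p)); [exact: dvdp0 | exact: dvdp_add | move=> i _].
rewrite linearZ /= row_gen poly_rV_K // -mul_polyC dvdp_mull //.
by rewrite -dvdp_mod // dvdp_mulIr.
Qed.

(** The first [k = n - deg g] rows need no reduction and form the free matrix [B]. Every row is a
    multiple [e * g] of degree below [n], hence a combination of those, with the coefficients of
    [e]. *)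
Lemma rank_negacyc_gen : \rank (negacyc_gen_mx n g) = (n - (size g).-1)%N.
Proof.
set k := (n - _)%N; have le_kn : (k <= n)%N by exact: leq_subr.
have kE : (k + size g = n.+1)%N.
  by rewrite -(prednK g_gt0) addnS subnK // -ltnS prednK.
pose B := \matrix_(i < k, j < n) ('X^i * g)`_j.
have rowB i : row i B = poly_rV ('X^i * g).
  by apply/rowP=> j; rewrite !mxE.
have size_le (p : {poly F}) : (size p <= k)%N -> (size (p * g)%R <= n)%N.
  move=> le_pk; apply: leq_trans (size_polyMleq _ _) _.
  by move: g_gt0 kE le_pk; lia.
have mulB (u : 'rV[F]_k) : u *m B = poly_rV (rVpoly u * g).
  rewrite mulmx_sum_row [in RHS](row_sum_delta u) !linear_sum mulr_suml linear_sum /=.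
  apply: eq_bigr => i _.
  by rewrite rowB !linearZ /= rVpoly_delta -scalerAl linearZ.
have B_free : row_free B.
  apply: inj_row_free => u; rewrite mulB => /(congr1 rVpoly).
  rewrite poly_rV_K ?size_le ?size_poly // linear0 => /eqP.
  rewrite mulf_eq0 [g == 0]negbTE ?monic_neq0 // orbF => /eqP u0.
  by rewrite -[u]rVpolyK u0 linear0.
have GB : (negacyc_gen_mx n g :=: B)%MS.
  apply/eqmxP/andP; split; apply/row_subP => i.
    have [e eE] : exists e : {poly F}, ('X^i * g) %% ('X^n + 1) = e * g.
      by apply/dvdpP; rewrite -dvdp_mod // dvdp_mulIr.
    have le_e : (size e <= k)%N.
      have [->|e0] := eqVneq e 0; first by rewrite size_poly0.
      have := size_mod ('X^i * g); rewrite eE size_Mmonic //.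
      move=> h; rewrite -(leq_add2r (size g)) kE.
      by apply: leq_trans (leqSpred _) _.
    by rewrite row_gen eE -[e](poly_rV_K le_e) -mulB submxMl.
  have -> : row i B = row (widen_ord le_kn i) (negacyc_gen_mx n g).
    rewrite rowB row_gen modp_small // size_Xn1 ltnS; apply: size_le.
    by rewrite size_polyXn; exact: ltn_ord i.
  exact: row_sub.
by rewrite GB; exact/eqP.
Qed.

End NegacyclicRank.

(** * The BCH bound *)

(** The zeros say that the weights [c_i b^i] annihilate the values at the points [z^i] of every
    polynomial of degree below [d]. With a support of at most [d] points, some such polynomial
    isolates a single one of them. *)
Lemma bch_bound (K : fieldType) (n d : nat) (b z : K) (c : 'rV[K]_n) :
  c != 0 -> b != 0 ->
  (forall i j : 'I_n, z ^+ i = z ^+ j -> i = j) ->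
  (forall j, (j < d)%N -> root (rVpoly c) (b * z ^+ j)) ->
  (d < #|[set i | c 0%R i != 0%R]|)%N.
Proof.
move=> c0 b0 z_inj rts; rewrite ltnNge; apply/negP => le_wd.
set S := [set i | _] in le_wd.
have eval0 (h : {poly K}) : (size h <= d)%N ->
    \sum_(i < n) c 0 i * b ^+ i * h.[z ^+ i] = 0.
  move=> le_hd.
  under eq_bigr => i _ do rewrite (horner_coef_wide _ le_hd) mulr_sumr.
  rewrite exchange_big big1 //= => j _.
  have /eqP := rts j (ltn_ord j).
  rewrite (horner_coef_wide _ (size_poly _ _ : size (rVpoly c) <= n)%N) => e.
  rewrite -[RHS](mulr0 h`_j) -[X in _ = _ * X]e mulr_sumr; apply: eq_bigr => i _.
  by rewrite coef_rVpoly_ord exprMn mulrCA -!mulrA -!exprM [(i * j)%N]mulnC.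
have [i0 ci0] : exists i, c 0 i != 0.
  by move: c0 => /eqP c0; apply/existsP; apply: contra_notT c0 => /existsPn h;
     apply/rowP => i; rewrite mxE; apply/eqP/negPn.
pose rs := [seq z ^+ (i : 'I_n) | i <- enum (S :\ i0)].
(* Among the terms of [eval0 h], only the one at i0 is nonzero. *)
pose h := \prod_(x <- rs) ('X - x%:P).
have root_h (i : 'I_n) : (h.[z ^+ i] == 0) = (i \in S :\ i0).
  rewrite -[LHS]/(root h _) root_prod_XsubC -mem_enum.
  exact: (mem_map (f := fun j : 'I_n => z ^+ j)).
have size_h : (size h <= d)%N.
  rewrite size_prod_XsubC size_map -cardE; apply: leq_trans le_wd.
  by rewrite (cardsD1 i0 S) inE ci0.
have /eqP := eval0 h size_h; apply/negP; rewrite (bigD1 i0) //= big1 => [|i i_neq].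
  by rewrite addr0 !mulf_neq0 ?expf_neq0 // root_h !inE eqxx.
have [->|ci] := eqVneq (c 0 i) 0; first by rewrite !mul0r.
by have /eqP-> : h.[z ^+ i] == 0; rewrite ?mulr0 // root_h !inE i_neq.
Qed.

(** * Minimal polynomials of powers of [beta] at coset representatives *)

Section ConjugateRoots.
Variables (F : finFieldType) (L : fieldExtType F) (m : nat) (beta : L).
Local Notation q := #|F|.
Hypotheses (q_odd : odd q) (m_gt1 : (1 < m)%N) (dimL : \dim {:L} = m).
Hypothesis beta_prim : (q ^ m - 1)%N.-primitive_root beta.

Let q_gt1 : (1 < q)%N. Proof. exact: finNzRing_gt1. Qed.

Lemma root_expr_card (p : {poly F}) a k :
  root (map_poly (in_alg L) p) (beta ^+ a) ->
  root (map_poly (in_alg L) p) (beta ^+ (a * q ^ k)).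
Proof.
elim: k => [|k IH] rt; first by rewrite muln1.
have /eqP r0 := IH rt.
by rewrite expnSr mulnA exprM /root horner_map_card r0 expr0n gtn_eqF // ltnW.
Qed.

Let conjugates a := [seq beta ^+ (a * q ^ i) | i <- iota 0 m].

Let root_conjugates a :
  all (root (map_poly (in_alg L) (minpoly_over (beta ^+ a)))) (conjugates a).
Proof.
apply/allP => _ /mapP[i _ ->]; apply: root_expr_card.
by have [] := minpoly_overP (beta ^+ a).
Qed.

Let uniq_conjugates a : small_rep q m a -> uniq (conjugates a).
Proof.
move=> ra; rewrite map_inj_in_uniq ?iota_uniq // => i j.
rewrite !mem_iota !add0n /= => lt_i lt_j /eqP.
rewrite (eq_prim_root_expr beta_prim) => /eqP eq_ij.
by have [] := small_rep_mod_inj q_odd q_gt1 m_gt1 ra ra lt_i lt_j eq_ij.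
Qed.

(** The [m] distinct conjugates force degree at least [m]; the dimension of [L] caps it at [m]. *)
Lemma size_minpoly_small_rep a :
  small_rep q m a -> size (minpoly_over (beta ^+ a)) = m.+1.
Proof.
move=> ra; apply/eqP; rewrite eqn_leq -{1}dimL size_minpoly_over.
rewrite -(size_map_poly (in_alg L)) -{1}(size_iota 0 m).
rewrite -(size_map (fun i => beta ^+ (a * q ^ i))).
apply: max_poly_roots; rewrite ?root_conjugates ?uniq_conjugates //.
by rewrite map_poly_eq0 monic_neq0 ?minpoly_over_monic.
Qed.

Let minpoly_conjugates a : small_rep q m a ->
  map_poly (in_alg L) (minpoly_over (beta ^+ a))
    = \prod_(z <- conjugates a) ('X - z%:P).
Proof.
move=> ra; rewrite [LHS](@all_roots_prod_XsubC _ _ (conjugates a)).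
- by rewrite lead_coef_map (monicP (minpoly_over_monic _)) rmorph1 scale1r.
- by rewrite size_map_poly size_minpoly_small_rep // size_map size_iota.
- exact: root_conjugates.
- by rewrite uniq_rootsE uniq_conjugates.
Qed.

(** Both polynomials split over [L] into their conjugates, so a common root would be a collision
    between two cosets. *)
Lemma coprimep_minpoly_small_rep a b : small_rep q m a -> small_rep q m b ->
  a != b -> coprimep (minpoly_over (beta ^+ a)) (minpoly_over (beta ^+ b)).
Proof.
move=> ra rb neq_ab; rewrite -(coprimep_map (in_alg L)) (minpoly_conjugates rb).
rewrite big_seq; apply: (big_ind (coprimep _)); first exact: coprimep1.
  by move=> p r cp cr; rewrite coprimepMr cp.
move=> _ /mapP[j lt_j ->]; rewrite coprimep_XsubC minpoly_conjugates //.
rewrite root_prod_XsubC; apply: contra neq_ab => /mapP[i lt_i /eqP].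
rewrite !mem_iota /= in lt_i lt_j.
rewrite (eq_prim_root_expr beta_prim) => /eqP /esym eq_ab.
by have [->] := small_rep_mod_inj q_odd q_gt1 m_gt1 ra rb lt_i lt_j eq_ab.
Qed.

End ConjugateRoots.

(** * Generator, dimension and distance of the negacyclic BCH code *)

Theorem theorem14 (F : finFieldType) (L : fieldExtType F) (q m l : nat)
    (alpha : L) (delta : nat) :
  #|F| = q -> odd q -> (2 <= m)%N ->
  let n := ((q ^ m - 1) %/ 2)%N in
  (* l is the multiplicative order of q modulo 2n *)
  (0 < l)%N -> (q ^ l == 1 %[mod 2 * n])%N ->
  (forall k, (0 < k < l)%N -> (q ^ k != 1 %[mod 2 * n])%N) ->
  (* L = GF(q^l), alpha a primitive element, beta = alpha^((q^l-1)/(2n)) *)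
  \dim {:L} = l -> (q ^ l - 1)%N.-primitive_root alpha ->
  let beta := alpha ^+ ((q ^ l - 1) %/ (2 * n)) in
  (2 <= delta)%N ->
  (if ~~ odd m then (delta <= q ^ (m %/ 2) + 1)%N
   else (delta <= (q ^ ((m + 1) %/ 2) + 1) %/ 2)%N) ->
  let g := negaBCH_gen beta delta 0 in
  let G := negacyc_gen_mx n g in
  [/\ g = \prod_(0 <= i < delta.-1 | (i != (q - 1) %/ 2 %[mod q])%N)
            minpoly_over (beta ^+ (1 + 2 * i)),
      \rank G = (n - m * (((2 * delta - 3) * (q - 1) + (2 * q).-1) %/ (2 * q)))%N
    & forall c1 c2 : 'rV[F]_n, (c1 <= G)%MS -> (c2 <= G)%MS -> c1 != c2 ->
        ((if (delta == (q + 1) %/ 2 %[mod q])%N then delta.+1 else delta)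
           <= hdist c1 c2)%N].
Proof.
move=> <-{q}; set q := #|F| => q_odd m_gt1 n l_gt0 ql_mod l_min dimL alpha_prim.
move=> beta delta_ge2 delta_le g G.
have q_gt1 : (1 < q)%N by exact: finNzRing_gt1.
have q_ge3 : (2 < q)%N by move: (q) q_odd q_gt1 => [|[|[|?]]].
have q_gt0 : (0 < q)%N by lia.
have n2E : (2 * n = q ^ m - 1)%N.
  rewrite /n; have : odd (q ^ m) by rewrite oddX q_odd orbT.
  lia.
have qm_gt : (q < q ^ m)%N by rewrite -[X in (X < _)%N]expn1 ltn_exp2l.
(* As [2n = q ^ m - 1], [l > m] contradicts minimality at [m], while for [l < m] the power [q ^ l]
   is its own residue and exceeds 1. *)
have lE : l = m.
  case: (ltngtP l m) => // lt_lm; last first.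
    have := l_min m; rewrite n2E lt_lm (ltnW m_gt1) => /(_ isT).
    by rewrite eqn_mod_dvd ?dvdnn // expn_gt0 q_gt0.
  have l_ge : (q <= q ^ l)%N by rewrite -[X in (X <= _)%N]expn1 leq_exp2l.
  have le_lm : (q * q ^ l <= q ^ m)%N by rewrite -expnS leq_exp2l.
  have : (3 * q ^ l <= q * q ^ l)%N by rewrite leq_mul2r q_ge3 orbT.
  move: ql_mod; rewrite n2E => /[swap] h3; rewrite !modn_small; lia.
have betaE : beta = alpha.
  by rewrite /beta n2E lE divnn subn_gt0 (ltn_trans q_gt1).
have beta_prim : (q ^ m - 1)%N.-primitive_root beta by rewrite betaE -lE.
rewrite {}lE in dimL; clear l_gt0 ql_mod l_min alpha_prim betaE; clearbody beta.
have small_bound i : (i < delta.-1)%N -> (1 + 2 * i < coset_bound q m)%N.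
  move=> lt_i; move: delta_le; rewrite /coset_bound.
  case m_odd: (odd m) => /=.
    have -> : ((m + 1) %/ 2 = uphalf m)%N by lia.
    lia.
  have -> : (m %/ 2 = uphalf m)%N by lia.
  lia.
pose s := [seq i <- iota 0 delta.-1 | (i != (q - 1) %/ 2 %[mod q])%N].
pose M i := minpoly_over (beta ^+ (1 + 2 * i)).
have Mmonic i : M i \is monic by exact: minpoly_over_monic.
have s_rep i : i \in s -> small_rep q m (1 + 2 * i).
  rewrite mem_filter mem_iota -dvdn_double_succ // => /andP[qNi lt_i].
  by rewrite /small_rep qNi small_bound // oddD oddM.
have gE : g = lcm_seq [seq M j | j <- iota 0 delta.-1] by [].
have g_mon : g \is monic by rewrite gE; apply: lcm_seq_monic => _ /mapP[i _ ->].
have dvd_g d : (g %| d) = all (fun i => M i %| d) (iota 0 delta.-1).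
  by rewrite gE dvdp_lcm_seq ?all_map // => _ /mapP[i _ ->].
have dvd_P d : (\prod_(i <- s) M i %| d) = all (fun i => M i %| d) s.
  apply: dvdp_prod_coprime; last by rewrite filter_uniq ?iota_uniq.
  move=> i j si sj neq_ij.
  by apply: (coprimep_minpoly_small_rep (m := m)); rewrite ?s_rep //; lia.
(* Each exponent [1 + 2 * i] is [b * q ^ k] for a representative [b] whose index [b %/ 2] lies in
   [s]; Frobenius carries the root at [b] to the one at [1 + 2 * i]. *)
have all_s d :
    all (fun i => M i %| d) s = all (fun i => M i %| d) (iota 0 delta.-1).
  apply/allP/allP => [h i|h i]; last by rewrite mem_filter => /andP[_]; exact: h.
  rewrite mem_iota /= => lt_i; rewrite /M dvdp_minpoly_over.
  have odd_i : odd (1 + 2 * i) by rewrite oddD oddM.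
  have [b [k [b_rep le_b ->]]] := small_repP q_odd q_gt1 odd_i (small_bound i lt_i).
  apply: root_expr_card; rewrite -dvdp_minpoly_over.
  have [b_odd qNb _] := and3P b_rep.
  have bE : b = (1 + 2 * (b %/ 2))%N by lia.
  rewrite bE; apply: h; rewrite mem_filter mem_iota -dvdn_double_succ // -bE qNb.
  lia.
(* Two monic polynomials with the same multiples are equal. *)
have g_prod : g = \prod_(i <- s) M i.
  apply/eqP; rewrite -eqp_monic ?monic_prod // /eqp.
  by rewrite dvd_g -all_s -dvd_P dvdpp dvd_P all_s -dvd_g dvdpp.
have n_gt0 : (0 < n)%N by lia.
have beta_n : beta ^+ n = -1.
  have /eqP : beta ^+ n ^+ 2 = 1 by rewrite -exprM mulnC n2E prim_expr_order.
  rewrite sqrf_eq1 => /orP[|/eqP //].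
  by rewrite -(prim_order_dvd beta_prim) -n2E => /(dvdn_leq n_gt0); lia.
have g_dvd : g %| 'X^n + 1.
  rewrite dvd_g; apply/allP => i _; rewrite /M dvdp_minpoly_over.
  rewrite rmorphD rmorph1 /= map_polyXn /root hornerD hornerXn hornerC.
  by rewrite exprAC beta_n exprD exprM sqrrN !expr1n mulr1 addNr.
split.
- by rewrite g_prod /s big_filter /index_iota subn0.
- rewrite rank_negacyc_gen // g_prod (size_prod_monic (k := m)) /=; last first.
    move=> i si; rewrite Mmonic; split=> //.
    exact/size_minpoly_small_rep/s_rep.
  rewrite size_filter count_nonmultiples //; last by lia.
  by rewrite (_ : 2 * delta.-1 - 1 = 2 * delta - 3)%N //; lia.
move=> c1 c2 c1G c2G neq_c.
(* The distance is the weight of [c1 - c2], read in [L], where the zeros lie. *)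
have -> : hdist c1 c2 = #|[set i | map_mx (in_alg L) (c1 - c2) 0%R i != 0%R]|.
  rewrite /hdist; apply: eq_card => i.
  by rewrite !inE mxE fmorph_eq0 !mxE subr_eq0.
have g_c : g %| rVpoly (c1 - c2).
  by apply: dvdp_negacyc_gen => //; rewrite addmx_sub ?eqmx_opp.
have c_root i : (i < delta.-1)%N ->
    root (map_poly (in_alg L) (rVpoly (c1 - c2))) (beta ^+ (1 + 2 * i)).
  move=> lt_i; rewrite -dvdp_minpoly_over.
  by move: g_c; rewrite dvd_g => /allP; apply; rewrite mem_iota.
set d := if _ then _ else _.
(* [bch_bound] gives a weight strictly above the number of zeros, so [d - 1] zeros suffice. *)
rewrite -(prednK (_ : 0 < d)%N); last by rewrite /d; case: ifP; lia.
apply: (@bch_bound _ _ _ beta (beta ^+ 2)).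
- by rewrite map_mx_eq0 subr_eq0.
- apply/eqP => b0; have /eqP := beta_n.
  by rewrite b0 expr0n gtn_eqF // eq_sym oppr_eq0 oner_eq0.
- move=> i j /eqP; rewrite -!exprM (eq_prim_root_expr beta_prim) -n2E.
  have := ltn_ord i; have := ltn_ord j => lt_j lt_i.
  by rewrite !modn_small ?ltn_pmul2l // => /eqP e; apply: val_inj => /=; lia.
move=> j lt_j; rewrite -map_rVpoly -exprM -exprS -[(2 * j).+1]/(1 + 2 * j)%N.
have [lt_jd|le_dj] := ltnP j delta.-1; first exact: c_root.
move: lt_j; rewrite /d; case: ifP => [delta_mod|_]; last by lia.
(* The extra exponent is [2 * delta - 1 = a * q] with [a] odd; [3 a <= 2 * delta - 1] puts the index
   [a %/ 2] below [delta - 1]. *)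
move=> lt_j; have {lt_j le_dj} jE : j = delta.-1 by lia.
have : (q %| 1 + 2 * j)%N.
  rewrite dvdn_double_succ // -(eqn_modDr 1) jE addn1 prednK; last by lia.
  by rewrite (eqP delta_mod); apply/eqP; congr (_ %% _)%N; lia.
case/dvdnP=> a aE; rewrite aE -[q in (a * q)%N]expn1.
have a_odd : odd a.
  have : odd (1 + 2 * j) by rewrite oddD oddM.
  by rewrite aE oddM => /andP[].
have -> : a = (1 + 2 * (a %/ 2))%N by lia.
apply/root_expr_card/c_root.
have : (a * 3 <= a * q)%N by rewrite leq_mul2l q_ge3 orbT.
rewrite -aE; lia.
Qed.
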